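(* Let the Fine numbers $f_n$ be defined by $f_0=1$, $f_1=0$ and $2(n + 1)f_n = (7n-5)f_{n-1} + 2(2n-1)f_{n-2}$ for $n\geq 2$. The sequence $\{f_n\}_{n\geq 5}$ is ratio log-concave, and the sequence $\{\sqrt[n]{f_n}\}_{n\geq 2}$ is strictly log-concave.
   Context: A sequence $(x_n)_{n\ge m}$ of positive reals is log-concave if $x_n^2\ge x_{n-1}x_{n+1}$ for all $n\ge m+1$, strictly log-concave if the inequality is strict. A sequence $(a_n)_{n\ge m}$ of positive reals is ratio log-concave if $(a_{n+1}/a_n)_{n\ge m}$ is log-concave. *)

(* Defs.v *)
From Stdlib Require Import Reals Lra Lia.
Open Scope R_scope.

Definition positive_from (m : nat) (x : nat -> R) : Prop :=
  forall n : nat, (m <= n)%nat -> 0 < x n.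

Definition log_concave (m : nat) (x : nat -> R) : Prop :=
  positive_from m x /\
  forall n : nat, (m + 1 <= n)%nat -> x n ^ 2 >= x (n - 1)%nat * x (n + 1)%nat.

Definition strictly_log_concave (m : nat) (x : nat -> R) : Prop :=
  positive_from m x /\
  forall n : nat, (m + 1 <= n)%nat -> x n ^ 2 > x (n - 1)%nat * x (n + 1)%nat.

Definition ratio_log_concave (m : nat) (a : nat -> R) : Prop :=
  positive_from m a /\ log_concave m (fun n => a (n + 1)%nat / a n).

(* [Rpower x y] is [exp (y * ln x)]: this is the n-th root only for [0 < x] and
   [n <> 0]. *)
Definition nth_root (n : nat) (x : R) : R := Rpower x (/ INR n).

Definition is_fine (f : nat -> R) : Prop :=
  f 0%nat = 1 /\ f 1%nat = 0 /\
  forall n : nat, (2 <= n)%nat ->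
    2 * (INR n + 1) * f n =
      (7 * INR n - 5) * f (n - 1)%nat + 2 * (2 * INR n - 1) * f (n - 2)%nat.

(* [fine_pair n] is the pair of the n-th and (n+1)-st Fine numbers. *)
Fixpoint fine_pair (n : nat) : R * R :=
  match n with
  | O => (1, 0)
  | S k =>
      let (a, b) := fine_pair k in
      let N := INR (k + 2) in
      (b, ((7 * N - 5) * b + 2 * (2 * N - 1) * a) / (2 * (N + 1)))
  end.

Definition fine (n : nat) : R := fst (fine_pair n).

Lemma fine_is_fine : is_fine fine.
Proof.
split; [reflexivity | split; [reflexivity |]].
intros n Hn.
destruct n as [|[|k]]; [lia | lia |].
replace (S (S k) - 1)%nat with (S k) by lia.
replace (S (S k) - 2)%nat with k by lia.
unfold fine; cbn [fine_pair].
destruct (fine_pair k) as [a b]; cbn [fst snd].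
replace (k + 2)%nat with (S (S k)) by lia.
pose proof (pos_INR (S (S k))).
field; lra.
Qed.

Lemma is_fine_unique (f g : nat -> R) :
  is_fine f -> is_fine g -> forall n, f n = g n.
Proof.
intros [f0 [f1 fr]] [g0 [g1 gr]] n.
enough (f n = g n /\ f (S n) = g (S n)) by tauto.
induction n as [|n [IH1 IH2]]; [split; congruence | split; [exact IH2 |]].
assert (Hf := fr (S (S n)) ltac:(lia)).
assert (Hg := gr (S (S n)) ltac:(lia)).
replace (S (S n) - 1)%nat with (S n) in Hf, Hg by lia.
replace (S (S n) - 2)%nat with n in Hf, Hg by lia.
rewrite IH1, IH2, <- Hg in Hf.
apply Rmult_eq_reg_l in Hf; [exact Hf |].
pose proof (pos_INR (S (S n))); lra.
Qed.

(* Main.v *)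
Require Import Defs.
From Stdlib Require Import Reals Lra Lia.
From Coquelicot Require Import Rcomplements.
Open Scope R_scope.

(** The ratios [r_n = f_(n+1) / f_n] satisfy [r_(n+1) = p_n + q_n / r_n], so
    [r_n] determines both neighbours [r_(n-1) = q_(n-1) / (r_n - p_(n-1))] and
    [r_(n+1)], each a decreasing function of [r_n].  Hence
    [r_(n-1) r_(n+1) <= r_n ^ 2] holds as soon as it holds with [r_n] replaced
    by a lower bound.  An explicit rational lower bound is propagated along the
    recursion together with an upper bound, each step exchanging the two.

    For the roots, let [D n], the [root_defect f n] below, be
    [n (n+1) (n+2)] times
    [2 ln f_(n+1) / (n+1) - ln f_n / n - ln f_(n+2) / (n+2)].  Ratio
    log-concavity makes [D] nondecreasing, which leaves finitely many [n] to
    check. *)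

Lemma log_concave_iff (m : nat) (x : nat -> R) :
  log_concave m x <->
  positive_from m x /\
  forall n, (m <= n)%nat -> x n * x (n + 2)%nat <= x (n + 1)%nat ^ 2.
Proof.
split; intros [x_pos H]; split; try exact x_pos; intros n Hn.
- specialize (H (n + 1)%nat ltac:(lia)).
  replace (n + 1 - 1)%nat with n in H by lia.
  replace (n + 1 + 1)%nat with (n + 2)%nat in H by lia.
  now apply Rge_le.
- specialize (H (n - 1)%nat ltac:(lia)).
  replace (n - 1 + 1)%nat with n in H by lia.
  replace (n - 1 + 2)%nat with (n + 1)%nat in H by lia.
  now apply Rle_ge.
Qed.

Lemma strictly_log_concave_iff (m : nat) (x : nat -> R) :
  strictly_log_concave m x <->
  positive_from m x /\
  forall n, (m <= n)%nat -> x n * x (n + 2)%nat < x (n + 1)%nat ^ 2.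
Proof.
split; intros [x_pos H]; split; try exact x_pos; intros n Hn.
- specialize (H (n + 1)%nat ltac:(lia)).
  replace (n + 1 - 1)%nat with n in H by lia.
  now replace (n + 1 + 1)%nat with (n + 2)%nat in H by lia.
- specialize (H (n - 1)%nat ltac:(lia)).
  replace (n - 1 + 1)%nat with n in H by lia.
  now replace (n - 1 + 2)%nat with (n + 1)%nat in H by lia.
Qed.

Lemma Rdiv_le_contravar (a x y : R) :
  0 <= a -> 0 < x -> x <= y -> a / y <= a / x.
Proof.
intros Ha Hx Hxy.
apply Rmult_le_compat_l; [exact Ha | now apply Rinv_le_contravar].
Qed.

Definition ratio (f : nat -> R) (n : nat) : R := f (n + 1)%nat / f n.

Section ThreeTermRecurrence.

Variables (p q f : nat -> R) (m : nat).
Hypothesis p_nonneg : forall n, (m <= n)%nat -> 0 <= p n.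
Hypothesis q_pos : forall n, (m <= n)%nat -> 0 < q n.
Hypothesis f_rec : forall n, (m <= n)%nat ->
  f (n + 2)%nat = p n * f (n + 1)%nat + q n * f n.

Lemma recurrence_positive_from :
  0 < f m -> 0 < f (m + 1)%nat -> positive_from m f.
Proof.
intros Hm Hm1 n Hn.
enough (0 < f n /\ 0 < f (n + 1)%nat) by tauto.
induction Hn as [|n Hn [IH1 IH2]]; [now split |].
replace (S n) with (n + 1)%nat by lia.
replace (n + 1 + 1)%nat with (n + 2)%nat by lia.
split; [exact IH2 |].
rewrite f_rec by exact Hn.
apply Rplus_le_lt_0_compat.
- apply Rmult_le_pos; [now apply p_nonneg | lra].
- apply Rmult_lt_0_compat; [now apply q_pos | lra].
Qed.

Hypothesis f_pos : positive_from m f.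

Lemma ratio_pos (n : nat) : (m <= n)%nat -> 0 < ratio f n.
Proof. intros Hn; apply Rdiv_lt_0_compat; apply f_pos; lia. Qed.

Lemma ratio_succ (n : nat) :
  (m <= n)%nat -> ratio f (n + 1) = p n + q n / ratio f n.
Proof.
intros Hn; unfold ratio.
replace (n + 1 + 1)%nat with (n + 2)%nat by lia.
rewrite f_rec by exact Hn.
assert (0 < f n) by (apply f_pos; lia).
assert (0 < f (n + 1)%nat) by (apply f_pos; lia).
field; lra.
Qed.

Lemma ratio_pred (n : nat) :
  (m <= n)%nat -> ratio f n = q n / (ratio f (n + 1) - p n).
Proof.
intros Hn.
assert (Hr := ratio_pos n Hn).
assert (Hq := q_pos n Hn).
rewrite ratio_succ by exact Hn.
field; split; [lra |].
replace (p n * ratio f n + q n - p n * ratio f n) with (q n) by ring.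
lra.
Qed.

Lemma ratio_between (l u : nat -> R) :
  (forall n, (m <= n)%nat -> 0 < l n) ->
  (forall n, (m <= n)%nat -> l (n + 1)%nat <= p n + q n / u n) ->
  (forall n, (m <= n)%nat -> p n + q n / l n <= u (n + 1)%nat) ->
  l m <= ratio f m <= u m ->
  forall n, (m <= n)%nat -> l n <= ratio f n <= u n.
Proof.
intros l_pos l_step u_step base n Hn.
induction Hn as [|n Hn [IHl IHu]]; [exact base |].
replace (S n) with (n + 1)%nat by lia.
rewrite ratio_succ by exact Hn.
assert (Hq := Rlt_le _ _ (q_pos n Hn)).
split.
- apply (Rle_trans _ _ _ (l_step n Hn)), Rplus_le_compat_l.
  apply Rdiv_le_contravar; auto using ratio_pos.
- refine (Rle_trans _ _ _ _ (u_step n Hn)); apply Rplus_le_compat_l.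
  apply Rdiv_le_contravar; auto.
Qed.

Lemma ratio_log_concave_of_lower_bound (l : nat -> R) :
  (forall n, (m <= n)%nat -> l (n + 1)%nat <= ratio f (n + 1)) ->
  (forall n, (m <= n)%nat -> p n < l (n + 1)%nat) ->
  (forall n, (m <= n)%nat ->
     q n / (l (n + 1)%nat - p n)
       * (p (n + 1)%nat + q (n + 1)%nat / l (n + 1)%nat)
     <= l (n + 1)%nat ^ 2) ->
  ratio_log_concave m f.
Proof.
intros l_le l_gt l_ineq.
split; [exact f_pos | apply log_concave_iff; split; [exact ratio_pos |]].
intros n Hn.
change (ratio f n * ratio f (n + 2) <= ratio f (n + 1) ^ 2).
replace (n + 2)%nat with (n + 1 + 1)%nat by lia.
rewrite (ratio_pred n), (ratio_succ (n + 1)) by lia.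
assert (Hp := p_nonneg n Hn); assert (Hq := q_pos n Hn).
assert (Hp' := p_nonneg (n + 1)%nat ltac:(lia)).
assert (Hq' := q_pos (n + 1)%nat ltac:(lia)).
specialize (l_le n Hn); specialize (l_gt n Hn); specialize (l_ineq n Hn).
set (r := ratio f (n + 1)) in *; set (s := l (n + 1)%nat) in *.
transitivity (s ^ 2); [| apply pow_incr; lra].
refine (Rle_trans _ _ _ _ l_ineq).
apply Rmult_le_compat.
- apply Rdiv_le_0_compat; lra.
- apply Rplus_le_le_0_compat, Rdiv_le_0_compat; lra.
- apply Rdiv_le_contravar; lra.
- apply Rplus_le_compat_l, Rdiv_le_contravar; lra.
Qed.

End ThreeTermRecurrence.

Definition root_defect (f : nat -> R) (n : nat) : R :=
  2 * INR n * (INR n + 2) * ln (f (n + 1)%nat)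
  - (INR n + 1) * (INR n + 2) * ln (f n)
  - INR n * (INR n + 1) * ln (f (n + 2)%nat).

Lemma root_defect_pos_iff_nth_root (f : nat -> R) (n : nat) :
  (1 <= n)%nat ->
  0 < root_defect f n <->
  nth_root n (f n) * nth_root (n + 2) (f (n + 2)%nat)
    < nth_root (n + 1) (f (n + 1)%nat) ^ 2.
Proof.
intros Hn.
apply (le_INR 1) in Hn; simpl in Hn.
unfold nth_root, Rpower; simpl pow.
rewrite Rmult_1_r, <- !exp_plus, !plus_INR; simpl (INR 1); simpl (INR 2).
set (scale := INR n * (INR n + 1) * (INR n + 2)).
assert (scale_pos : 0 < scale).
{ unfold scale; repeat apply Rmult_lt_0_compat; lra. }
set (L := / INR n * _ + _); set (M := _ + _).
assert (E : root_defect f n = scale * (M - L)).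
{ unfold root_defect, scale, L, M; field; lra. }
rewrite E; split; intros H.
- apply exp_increasing, Rminus_lt_0, (Rmult_lt_reg_l scale); lra.
- apply exp_lt_inv, Rminus_lt_0 in H; now apply Rmult_lt_0_compat.
Qed.

Lemma root_defect_pos_iff_pow (f : nat -> R) (n : nat) :
  0 < f n -> 0 < f (n + 1)%nat -> 0 < f (n + 2)%nat ->
  0 < root_defect f n <->
  f n ^ ((n + 1) * (n + 2)) * f (n + 2)%nat ^ (n * (n + 1))
    < f (n + 1)%nat ^ (2 * n * (n + 2)).
Proof.
intros H0 H1 H2.
set (L := _ * _); set (M := _ ^ (2 * n * _)).
assert (L_pos : 0 < L) by (apply Rmult_lt_0_compat; now apply pow_lt).
assert (M_pos : 0 < M) by now apply pow_lt.
assert (E : root_defect f n = ln M - ln L).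
{ unfold root_defect, L, M.
  rewrite ln_mult, !ln_pow by auto using pow_lt.
  rewrite !mult_INR, !plus_INR; simpl; ring. }
rewrite E, <- Rminus_lt_0; split.
- now apply ln_lt_inv.
- now apply ln_increasing.
Qed.

Lemma root_defect_nondecreasing (m : nat) (f : nat -> R) :
  ratio_log_concave m f -> forall n, (m <= n)%nat ->
  root_defect f n <= root_defect f (n + 1).
Proof.
intros [f_pos [r_pos H]%log_concave_iff] n Hn.
specialize (H n Hn).
assert (Hr0 := r_pos n Hn).
assert (Hr1 := r_pos (n + 1)%nat ltac:(lia)).
assert (Hr2 := r_pos (n + 2)%nat ltac:(lia)).
cbv beta in *.
apply ln_le in H; [| now apply Rmult_lt_0_compat].
rewrite ln_mult, ln_pow in H by assumption; simpl (INR 2) in H.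
rewrite !ln_div in H by (apply f_pos; lia).
unfold root_defect.
replace (n + 1 + 1)%nat with (n + 2)%nat in * by lia.
replace (n + 1 + 2)%nat with (n + 2 + 1)%nat by lia.
rewrite plus_INR; simpl (INR 1).
set (r0 := ln (f (n + 1)%nat) - ln (f n)) in *.
set (r1 := ln (f (n + 2)%nat) - ln (f (n + 1)%nat)) in *.
set (r2 := ln (f (n + 2 + 1)%nat) - ln (f (n + 2)%nat)) in *.
assert (Hx := pos_INR n).
assert (0 <= (INR n + 1) * (INR n + 2) * (2 * r1 - (r0 + r2))).
{ repeat apply Rmult_le_pos; lra. }
unfold r0, r1, r2 in *; lra.
Qed.

Lemma strictly_log_concave_nth_root (l m : nat) (f : nat -> R) :
  (1 <= l)%nat -> ratio_log_concave m f -> (l <= m)%nat ->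
  (forall n, (l <= n <= m)%nat -> 0 < root_defect f n) ->
  strictly_log_concave l (fun n => nth_root n (f n)).
Proof.
intros Hl f_rlc Hlm Hcheck.
apply strictly_log_concave_iff; split; [intros n _; apply exp_pos |].
intros n Hn.
apply root_defect_pos_iff_nth_root; [lia |].
destruct (Nat.le_ge_cases n m) as [Hnm | Hmn]; [now apply Hcheck |].
induction Hmn as [|n Hmn IH]; [apply Hcheck; lia |].
apply (Rlt_le_trans _ (root_defect f n)); [apply IH; lia |].
rewrite <- Nat.add_1_r.
now apply (root_defect_nondecreasing m).
Qed.

Definition fine_p (x : R) : R := (7 * x + 9) / (2 * (x + 3)).
Definition fine_q (x : R) : R := (2 * x + 3) / (x + 3).

(* The ratios of the Fine numbers are [ratio_bound d_n n] with [d_n] tending to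
   [20 / 81], which the two constants below enclose. *)
Definition ratio_bound (d x : R) : R := 4 - 6 / (x + 19 / 9 + d / x).
Definition lower_ratio : R -> R := ratio_bound (1 / 9).
Definition upper_ratio : R -> R := ratio_bound (1 / 2).

Ltac positive_coefficients :=
  match goal with |- 0 < ?e => ring_simplify e end;
  apply Rplus_le_lt_0_compat; [| lra];
  repeat match goal with
  | |- 0 <= _ + _ => apply Rplus_le_le_0_compat
  | |- 0 <= _ * _ => apply Rmult_le_pos
  | |- 0 <= _ ^ _ => apply pow_le
  end; lra.

(* In terms of [y = x - 5], every numerator and denominator that occurs has
   positive coefficients. *)
Ltac rational_lt x :=
  apply Rminus_lt_0;
  let y := fresh "y" in
  pose (y := x - 5);
  assert (0 <= y) by (unfold y; lra);
  replace x with (y + 5) by (unfold y; ring);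
  clearbody y;
  unfold fine_p, fine_q, lower_ratio, upper_ratio, ratio_bound;
  field_simplify;
  [ apply Rdiv_lt_0_compat; positive_coefficients
  | repeat split; apply not_eq_sym, Rlt_not_eq; positive_coefficients ].

Lemma lower_ratio_pos (x : R) : 5 <= x -> 0 < lower_ratio x.
Proof. intros Hx; rational_lt x. Qed.

Lemma fine_p_lt_lower_ratio (x : R) : 5 <= x -> fine_p x < lower_ratio (x + 1).
Proof. intros Hx; rational_lt x. Qed.

Lemma lower_ratio_succ (x : R) :
  5 <= x -> lower_ratio (x + 1) <= fine_p x + fine_q x / upper_ratio x.
Proof. intros Hx; apply Rlt_le; rational_lt x. Qed.

Lemma upper_ratio_succ (x : R) :
  5 <= x -> fine_p x + fine_q x / lower_ratio x <= upper_ratio (x + 1).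
Proof. intros Hx; apply Rlt_le; rational_lt x. Qed.

Lemma lower_ratio_neighbours_le_sq (x : R) :
  5 <= x ->
  fine_q x / (lower_ratio (x + 1) - fine_p x)
    * (fine_p (x + 1) + fine_q (x + 1) / lower_ratio (x + 1))
  <= lower_ratio (x + 1) ^ 2.
Proof. intros Hx; apply Rlt_le; rational_lt x. Qed.

Lemma fine_p_INR_nonneg (n : nat) : 0 <= fine_p (INR n).
Proof.
assert (Hx := pos_INR n).
apply Rdiv_le_0_compat; lra.
Qed.

Lemma fine_q_INR_pos (n : nat) : 0 < fine_q (INR n).
Proof.
assert (Hx := pos_INR n).
apply Rdiv_lt_0_compat; lra.
Qed.

Lemma five_le_INR (n : nat) : (5 <= n)%nat -> 5 <= INR n.
Proof. intros Hn%le_INR; simpl in Hn; lra. Qed.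

Section Fine.

Variable f : nat -> R.
Hypothesis hf : is_fine f.

Lemma fine_rec (n : nat) :
  f (n + 2)%nat = fine_p (INR n) * f (n + 1)%nat + fine_q (INR n) * f n.
Proof.
destruct hf as [_ [_ H]].
specialize (H (n + 2)%nat ltac:(lia)).
replace (n + 2 - 1)%nat with (n + 1)%nat in H by lia.
replace (n + 2 - 2)%nat with n in H by lia.
rewrite plus_INR in H; change (INR 2) with 2 in H.
assert (Hx := pos_INR n).
apply (Rmult_eq_reg_l (2 * (INR n + 2 + 1))); [rewrite H | lra].
unfold fine_p, fine_q; field; lra.
Qed.

Lemma fine_values :
  f 2%nat = 1 /\ f 3%nat = 2 /\ f 4%nat = 6 /\ f 5%nat = 18 /\
  f 6%nat = 57 /\ f 7%nat = 186.
Proof.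
destruct hf as [H0 [H1 _]].
assert (H2 := fine_rec 0); assert (H3 := fine_rec 1);
assert (H4 := fine_rec 2); assert (H5 := fine_rec 3);
assert (H6 := fine_rec 4); assert (H7 := fine_rec 5).
unfold fine_p, fine_q in *; simpl in *.
repeat split; lra.
Qed.

Lemma fine_positive_from : positive_from 2 f.
Proof.
destruct fine_values as [H2 [H3 _]].
apply (recurrence_positive_from (fun n => fine_p (INR n))
         (fun n => fine_q (INR n)));
  auto using fine_p_INR_nonneg, fine_q_INR_pos, fine_rec.
- rewrite H2; lra.
- simpl; rewrite H3; lra.
Qed.

Lemma fine_ratio_between (n : nat) : (5 <= n)%nat ->
  lower_ratio (INR n) <= ratio f n <= upper_ratio (INR n).
Proof.
revert n.
apply (ratio_between (fun n => fine_p (INR n)) (fun n => fine_q (INR n)));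
  auto using fine_q_INR_pos, fine_rec.
- intros n Hn; apply fine_positive_from; lia.
- auto using lower_ratio_pos, five_le_INR.
- intros n Hn; rewrite plus_INR; now apply lower_ratio_succ, five_le_INR.
- intros n Hn; rewrite plus_INR; now apply upper_ratio_succ, five_le_INR.
- destruct fine_values as [_ [_ [_ [H5 [H6 _]]]]].
  unfold ratio, lower_ratio, upper_ratio, ratio_bound; simpl (5 + 1)%nat.
  rewrite H5, H6; simpl; lra.
Qed.

Lemma fine_ratio_log_concave : ratio_log_concave 5 f.
Proof.
apply (ratio_log_concave_of_lower_bound (fun n => fine_p (INR n))
         (fun n => fine_q (INR n))) with (l := fun n => lower_ratio (INR n));
  auto using fine_p_INR_nonneg, fine_q_INR_pos, fine_rec.
- intros n Hn; apply fine_positive_from; lia.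
- intros n Hn; apply fine_ratio_between; lia.
- intros n Hn; rewrite plus_INR; now apply fine_p_lt_lower_ratio, five_le_INR.
- intros n Hn; rewrite plus_INR.
  now apply lower_ratio_neighbours_le_sq, five_le_INR.
Qed.

Lemma fine_root_defect_pos (n : nat) :
  (2 <= n <= 5)%nat -> 0 < root_defect f n.
Proof.
intros Hn.
apply root_defect_pos_iff_pow; try (apply fine_positive_from; lia).
destruct fine_values as [H2 [H3 [H4 [H5 [H6 H7]]]]].
assert (n = 2 \/ n = 3 \/ n = 4 \/ n = 5)%nat as [-> | [-> | [-> | ->]]] by lia;
  cbn [Nat.add];
  rewrite ?H2, ?H3, ?H4, ?H5, ?H6, ?H7, !pow_IZR, <- mult_IZR;
  now apply IZR_lt.
Qed.

End Fine.

Theorem theorem4p4 (f : nat -> R) (hf : is_fine f) :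
  ratio_log_concave 5 f /\
  strictly_log_concave 2 (fun n => nth_root n (f n)).
Proof.
assert (f_rlc := fine_ratio_log_concave f hf).
split; [exact f_rlc |].
apply (strictly_log_concave_nth_root 2 5); [lia | exact f_rlc | lia |].
exact (fine_root_defect_pos f hf).
Qed.
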